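(* (Multi-domain minimax-MSE prediction.) Let $\mathcal{A}$ and $\mathcal{B}$ be linear subspaces of functions from $\mathbb{R}^{M_1}$ to $\mathbb{R}^N$ and from $\mathbb{R}^{M_2}$ to $\mathbb{R}^N$, respectively, and let $\mathcal{F}$ be the set of joint distributions of $(X_1,X_2,Y)$ defined in the context. Choose any distribution $F_{X_1X_2Y}\in\mathcal{F}$ and consider the estimator $$\rho_{\mathcal{C}}=\arg\min_{\rho\in\mathcal{C}}\mathrm{MSE}(F_{X_1X_2Y},\rho),$$ where $\mathcal{C}=\mathcal{A}+\mathcal{B}$, namely $$\mathcal{C}=\{\rho:\ \rho(\boldsymbol{x}_1,\boldsymbol{x}_2)=\varphi(\boldsymbol{x}_1)+\psi(\boldsymbol{x}_2),\ \varphi\in\mathcal{A},\ \psi\in\mathcal{B}\}.$$ Then: 1. the function $\rho_{\mathcal{C}}$ does not depend on the choice of $F_{X_1X_2Y}\in\mathcal{F}$; 2. the value $\mathrm{MSE}(F_{X_1X_2Y},\rho_{\mathcal{C}})$ does not depend on the choice of $F_{X_1X_2Y}\in\mathcal{F}$; 3. the estimator $\rho_{\mathcal{C}}$ is also the solution $\rho_{\mathrm{M}}$ to the minimax problem $$\rho_{\mathrm{M}}=\arg\min_{\rho}\ \sup_{F_{X_1X_2Y}\in\mathcal{F}}\mathrm{MSE}(F_{X_1X_2Y},\rho),$$ where the minimization is over all functions $\rho$ of $X_1$ and $X_2$.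
   Context: $X_1,X_2,Y$ are random vectors taking values in $\mathbb{R}^{M_1},\mathbb{R}^{M_2},\mathbb{R}^N$, respectively. Given are: linear subspaces $\mathcal{A}$ and $\mathcal{B}$ of functions $\mathbb{R}^{M_1}\to\mathbb{R}^N$ and $\mathbb{R}^{M_2}\to\mathbb{R}^N$ (for example, all linear functions, all Borel-measurable functions, or only the zero function), two functions $\varphi_{\mathcal{A}}:\mathbb{R}^{M_1}\to\mathbb{R}^N$ and $\psi_{\mathcal{B}}:\mathbb{R}^{M_2}\to\mathbb{R}^N$, a cumulative distribution function $F_{X_1X_2}$ on $\mathbb{R}^{M_1}\times\mathbb{R}^{M_2}$, and a scalar $c>0$. $\mathcal{F}$ is the set of joint distributions $F_{X_1X_2Y}$ of $(X_1,X_2,Y)$ satisfying (i) $\varphi_{\mathcal{A}}=\arg\min_{\varphi\in\mathcal{A}}\mathbb{E}[\|Y-\varphi(X_1)\|^2]$; (ii) $\psi_{\mathcal{B}}=\arg\min_{\psi\in\mathcal{B}}\mathbb{E}[\|Y-\psi(X_2)\|^2]$; (iii) the marginal distribution of $(X_1,X_2)$ is $F_{X_1X_2}$, i.e. $F_{X_1X_2Y}(\boldsymbol{x}_1,\boldsymbol{x}_2,\infty)=F_{X_1X_2}(\boldsymbol{x}_1,\boldsymbol{x}_2)$; (iv) $\mathbb{E}[\|Y\|^2]=c$. For a distribution $F_{X_1X_2Y}$ and an estimator $\hat Y=\rho(X_1,X_2)$, $\mathrm{MSE}(F_{X_1X_2Y},\rho)=\mathbb{E}[\|Y-\rho(X_1,X_2)\|^2]$,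 the expectation being with respect to $F_{X_1X_2Y}$.
   Formalization: Added assumption, without which the claim fails: every square-integrable φ(X1)+ψ(X2) with φ∈A, ψ∈B is a mean-square limit of such sums with square-integrable summands; all functions are taken Borel measurable and uniqueness is almost sure. *)

(* Defs.v *)
From HB Require Import structures.
From mathcomp Require Import all_boot all_order all_algebra.
From mathcomp Require Import all_classical all_reals all_analysis.
From mathcomp Require Import measurable_realfun ring lra.

Set Implicit Arguments.
Unset Strict Implicit.
Unset Printing Implicit Defensive.

Import Order.TTheory GRing.Theory Num.Theory numFieldNormedType.Exports.

Local Open Scope classical_set_scope.
Local Open Scope ring_scope.

(** The Borel sigma-algebra on row vectors: generated, as for [n.-tuple T], by
    the coordinate maps. *)
Definition measure_rV_display : measure_display -> measure_display.
Proof. exact. Qed.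

Section measurable_rV.
Context {d} {T : sigmaRingType d}.
Variable n : nat.

Let coor : 'I_n -> 'rV[T]_n -> T := fun i v => v ord0 i.

Let rV_set0 : g_sigma_preimage coor set0.
Proof. exact: sigma_algebra0. Qed.

Let rV_setC S : g_sigma_preimage coor S -> g_sigma_preimage coor (~` S).
Proof. exact: sigma_algebraC. Qed.

Let rV_bigcup (F : _^nat) : (forall i, g_sigma_preimage coor (F i)) ->
  g_sigma_preimage coor (\bigcup_i (F i)).
Proof. exact: sigma_algebra_bigcup. Qed.

HB.instance Definition _ := @isMeasurable.Build (measure_rV_display d)
  'rV[T]_n (g_sigma_preimage coor) rV_set0 rV_setC rV_bigcup.

End measurable_rV.

(** The squared Euclidean norm; the library norm [`|v|] on matrices is the
    maximum norm. *)
Definition sqnorm (R : realType) (n : nat) (v : 'rV[R]_n) : R :=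
  \sum_(i < n) v ord0 i ^+ 2.

(** A set of minimizers: in a problem on mean-square errors, minimizers can only
    be unique up to almost sure equality. *)
Definition argmin (R : realType) (T : Type) (C : set T) (J : T -> \bar R) :
    set T :=
  [set f | C f /\ forall g, C g -> (J f <= J g)%E].

Section prediction.
Context {R : realType} {M1 M2 N : nat}.

(** All random vectors live on the space of values [((x1, x2), y)], where they
    are the coordinate maps, so that joint distributions are probability
    measures on this space. *)
Local Notation X12 := ('rV[R]_M1 * 'rV[R]_M2)%type.
Local Notation XY := ('rV[R]_M1 * 'rV[R]_M2 * 'rV[R]_N)%type.

Definition MSE (P : probability XY R) (rho : X12 -> 'rV[R]_N) : \bar R :=
  ('E_P[fun w : XY => sqnorm (w.2 - rho w.1)])%E.

Definition admissible (A : set ('rV[R]_M1 -> 'rV[R]_N))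
    (B : set ('rV[R]_M2 -> 'rV[R]_N))
    (phiA : 'rV[R]_M1 -> 'rV[R]_N) (psiB : 'rV[R]_M2 -> 'rV[R]_N)
    (P12 : probability X12 R) (c : R) : set (probability XY R) :=
  [set P : probability XY R |
    [/\ argmin A (fun phi => 'E_P[fun w : XY => sqnorm (w.2 - phi w.1.1)])%E phiA,
        argmin B (fun psi => 'E_P[fun w : XY => sqnorm (w.2 - psi w.1.2)])%E psiB,
        forall S : set X12, measurable S -> pushforward P fst S = P12 S &
        ('E_P[fun w : XY => sqnorm w.2] = c%:E)%E]].

Definition sum_space (A : set ('rV[R]_M1 -> 'rV[R]_N))
    (B : set ('rV[R]_M2 -> 'rV[R]_N)) : set (X12 -> 'rV[R]_N) :=
  [set (fun x => phi x.1 + psi x.2) | phi in A & psi in B].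

Definition worst_MSE (F : set (probability XY R)) (rho : X12 -> 'rV[R]_N) :
    \bar R :=
  ereal_sup [set MSE P rho | P in F].

Definition square_integrable (P12 : probability X12 R)
    (f : X12 -> 'rV[R]_N) : Prop :=
  ('E_P12[fun x => sqnorm (f x)] < +oo)%E.

(** The implicit second-moment requirement on [A] and [B]: a square-integrable
    [phi x1 + psi x2] is a mean-square limit of such sums with
    square-integrable summands.  It holds if all members of [A], or all members
    of [B], are square-integrable ([L2_dense_sums_left], [L2_dense_sums_right]),
    and also if [A] and [B] consist of all Borel functions
    ([L2_dense_sums_borel]).  Without it, [phi] and [psi] may fail to be
    square-integrable while their sum is; the conditions on the minimizers over
    [A] and [B] then say nothing about the correlation of [Y] with that sum. *)
Definition L2_dense_sums (P12 : probability X12 R)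
    (A : set ('rV[R]_M1 -> 'rV[R]_N)) (B : set ('rV[R]_M2 -> 'rV[R]_N)) : Prop :=
  forall rho, sum_space A B rho -> square_integrable P12 rho ->
  forall e : R, 0 < e ->
  exists phi psi,
    [/\ A phi /\ square_integrable P12 (phi \o fst),
        B psi /\ square_integrable P12 (psi \o snd) &
        ('E_P12[fun x => sqnorm (rho x - (phi x.1 + psi x.2))] < e%:E)%E].

End prediction.

Lemma measurable_rVP d (T : measurableType d) (R : realType) n
    (f : T -> 'rV[R]_n) :
  measurable_fun setT f <->
  forall i, measurable_fun setT (fun x => f x ord0 i).
Proof.
split=> [mf i|mf].
  apply: (measurableT_comp (f := fun v : 'rV[R]_n => v ord0 i)) => //.
  move=> _ Y mY; rewrite setTI; apply: sub_sigma_algebra => /=.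
  rewrite -bigcup_seq/=; exists i => /=; first by rewrite mem_index_enum.
  by exists Y => //; rewrite setTI.
move=> _ S mS; rewrite setTI.
pose coor i (v : 'rV[R]_n) := v ord0 i.
have : preimage_set_system setT f (g_sigma_preimage coor) (f @^-1` S).
  by exists S => //; rewrite setTI.
rewrite -g_sigma_preimageE; apply: smallest_sub.
  exact: sigma_algebra_measurable.
move=> _ [D + <-]; rewrite -bigcup_seq => -[i _ [Y mY <-]].
by rewrite !setTI; have := mf i measurableT Y mY; rewrite setTI.
Qed.

Lemma measurable_sqnorm d (T : measurableType d) (R : realType) n
    (f : T -> 'rV[R]_n) :
  measurable_fun setT f -> measurable_fun setT (fun x => sqnorm (f x)).
Proof.
move=> /measurable_rVP mf; rewrite /sqnorm.
by apply: measurable_sum => i; exact: measurable_funX.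
Qed.

Lemma sqnorm_ge0 (R : realType) n (v : 'rV[R]_n) : 0 <= sqnorm v.
Proof. by apply: sumr_ge0 => i _; rewrite sqr_ge0. Qed.

Lemma sqnormB_le (R : realType) n (u v : 'rV[R]_n) :
  sqnorm (u - v) <= 2 * (sqnorm u + sqnorm v).
Proof.
rewrite /sqnorm -big_split mulr_sumr; apply: ler_sum => i _ /=.
rewrite !mxE; move: (u _ _) (v _ _) => a b.
by have := sqr_ge0 (a + b); nra.
Qed.

Section second_moments.
Context {R : realType} {M1 M2 N : nat}.
Local Notation X12 := ('rV[R]_M1 * 'rV[R]_M2)%type.
Variable P12 : probability X12 R.

Lemma square_integrableB (f g : X12 -> 'rV[R]_N) :
  measurable_fun setT f -> measurable_fun setT g ->
  square_integrable P12 f -> square_integrable P12 g ->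
  square_integrable P12 (fun x => f x - g x).
Proof.
move=> mf mg; rewrite /square_integrable unlock => f2 g2.
have m2f := measurable_sqnorm mf; have m2g := measurable_sqnorm mg.
have mfg : measurable_fun setT (fun x => f x - g x).
  apply/measurable_rVP => i; apply: (eq_measurable_fun (fun x => f x ord0 i - g x ord0 i)).
    by move=> x _; rewrite !mxE.
  by apply: measurable_funB; [move/measurable_rVP: mf|move/measurable_rVP: mg].
apply: (@le_lt_trans _ _ (\int[P12]_x (2%:E * ((sqnorm (f x))%:E + (sqnorm (g x))%:E)))%E).
  apply: ge0_le_integral => //=.
  - by move=> x _; rewrite lee_fin sqnorm_ge0.
  - by apply/measurable_EFinP/measurable_sqnorm.
  - apply: measurable_funeM; apply: emeasurable_funD; exact/measurable_EFinP.
  - by move=> x _; rewrite -EFinD -EFinM lee_fin sqnormB_le.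
have p0 (h : X12 -> 'rV[R]_N) x : (0 <= (sqnorm (h x))%:E)%E.
  by rewrite lee_fin sqnorm_ge0.
have m2f' := (measurable_EFinP _ _).2 m2f.
have m2g' := (measurable_EFinP _ _).2 m2g.
rewrite ge0_integralZl ?lee_fin//; [|exact: emeasurable_funD|by move=> x _; rewrite adde_ge0].
rewrite ge0_integralD//.
by rewrite lte_mul_pinfty// lte_add_pinfty.
Qed.

Lemma measurable_fst_comp (phi : 'rV[R]_M1 -> 'rV[R]_N) :
  measurable_fun setT phi -> measurable_fun setT (phi \o @fst _ 'rV[R]_M2).
Proof. by move=> mphi; exact: measurableT_comp. Qed.

Lemma measurable_snd_comp (psi : 'rV[R]_M2 -> 'rV[R]_N) :
  measurable_fun setT psi -> measurable_fun setT (psi \o @snd 'rV[R]_M1 _).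
Proof. by move=> mpsi; exact: measurableT_comp. Qed.

Lemma measurable_sum_space (phi : 'rV[R]_M1 -> 'rV[R]_N)
    (psi : 'rV[R]_M2 -> 'rV[R]_N) :
  measurable_fun setT phi -> measurable_fun setT psi ->
  measurable_fun setT (fun x : X12 => phi x.1 + psi x.2).
Proof.
move=> /measurable_fst_comp/measurable_rVP mphi.
move=> /measurable_snd_comp/measurable_rVP mpsi; apply/measurable_rVP => i.
apply: (eq_measurable_fun (fun x : X12 => phi x.1 ord0 i + psi x.2 ord0 i)).
  by move=> x _; rewrite !mxE.
exact: measurable_funD.
Qed.

Lemma expectation_sqnorm0 (f g : X12 -> 'rV[R]_N) (e : R) :
  0 < e -> f = g -> ('E_P12[fun x => sqnorm (f x - g x)] < e%:E)%E.
Proof.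
move=> e0 ->; rewrite (_ : (fun x => _) = cst 0); first by rewrite expectation_cst lte_fin.
by apply/funext => x; rewrite subrr /sqnorm big1// => i _; rewrite mxE expr0n.
Qed.

Variables (A : set ('rV[R]_M1 -> 'rV[R]_N)) (B : set ('rV[R]_M2 -> 'rV[R]_N)).
Hypotheses (mA : A `<=` measurable_fun setT) (mB : B `<=` measurable_fun setT).

Lemma L2_dense_sums_left :
  (forall phi, A phi -> square_integrable P12 (phi \o fst)) ->
  L2_dense_sums P12 A B.
Proof.
move=> A2 _ [phi Aphi [psi Bpsi <-]] rho2 e e0; exists phi, psi.
split; [by split=> //; exact: A2| |exact: expectation_sqnorm0]; split=> //.
rewrite (_ : psi \o snd = fun x => (phi x.1 + psi x.2) - (phi \o fst) x).
  apply: square_integrableB => //; last exact: A2.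
  - by apply: measurable_sum_space; [exact: mA|exact: mB].
  - by apply: measurable_fst_comp; exact: mA.
by apply/funext => x /=; rewrite addrC addKr.
Qed.

Lemma L2_dense_sums_right :
  (forall psi, B psi -> square_integrable P12 (psi \o snd)) ->
  L2_dense_sums P12 A B.
Proof.
move=> B2 _ [phi Aphi [psi Bpsi <-]] rho2 e e0; exists phi, psi.
split; [|by split=> //; exact: B2|exact: expectation_sqnorm0]; split=> //.
rewrite (_ : phi \o fst = fun x => (phi x.1 + psi x.2) - (psi \o snd) x).
  apply: square_integrableB => //; last exact: B2.
  - by apply: measurable_sum_space; [exact: mA|exact: mB].
  - by apply: measurable_snd_comp; exact: mB.
by apply/funext => x /=; rewrite addrK.
Qed.

End second_moments.

Definition clip (R : realType) (k : nat) (t : R) : R :=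
  Num.max (- k%:R) (Num.min k%:R t).

Lemma clipP (R : realType) k (a : R) :
  [\/ a < - k%:R /\ clip k a = - k%:R, k%:R < a /\ clip k a = k%:R |
      (- k%:R <= a /\ a <= k%:R) /\ clip k a = a].
Proof.
have k0 : 0 <= k%:R :> R by [].
rewrite /clip; move: (k%:R) k0 => K K0.
have [Ka|aK] := ltP K a; first by apply: Or32; rewrite (max_idPr _)//; lra.
have [Ka|aK'] := ltP a (- K); first exact: Or31.
exact: Or33.
Qed.

Lemma clip_addB (R : realType) k (a b : R) :
  ((a + b) - (clip k a + clip k b)) ^+ 2 <= (a + b) ^+ 2.
Proof.
have k0 : 0 <= k%:R :> R by [].
have := clipP k a; have := clipP k b; move: (clip k a) (clip k b) => u v.
move: (k%:R) k0 => K K0 hb ha.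
have : (0 <= u + v /\ u + v <= a + b) \/ (a + b <= u + v /\ u + v <= 0).
  have [ab|ab] := leP 0 (a + b); [left|right];
  case: ha => -[? ?]; case: hb => -[? ?]; split; lra.
by case=> -[]; nra.
Qed.

Lemma clip_bound (R : realType) k (a : R) : clip k a ^+ 2 <= k%:R ^+ 2.
Proof.
have k0 : 0 <= k%:R :> R by [].
by case: (clipP k a) => -[? ->]; nra.
Qed.

Lemma clip_id (R : realType) k (a : R) : `|a| <= k%:R -> clip k a = a.
Proof.
rewrite ler_norml => /andP[ka ak]; rewrite /clip.
by rewrite (min_idPr _)// (max_idPr _).
Qed.

Section borel.
Context {R : realType} {M1 M2 N : nat}.
Local Notation X12 := ('rV[R]_M1 * 'rV[R]_M2)%type.
Variable P12 : probability X12 R.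

Let clipv k (v : 'rV[R]_N) : 'rV[R]_N := \row_i clip k (v ord0 i).

Let measurable_clipv d (T : measurableType d) k (f : T -> 'rV[R]_N) :
  measurable_fun setT f -> measurable_fun setT (clipv k \o f).
Proof.
move=> /measurable_rVP mf; apply/measurable_rVP => i.
apply: (eq_measurable_fun (fun x => clip k (f x ord0 i))).
  by move=> x _; rewrite /= mxE.
by apply: measurable_maxr => //; exact: measurable_minr.
Qed.

Let square_integrable_clipv k (f : X12 -> 'rV[R]_N) :
  measurable_fun setT f -> square_integrable P12 (clipv k \o f).
Proof.
move=> mf; rewrite /square_integrable unlock.
apply: (@le_lt_trans _ _ (\int[P12]_x (cst (\sum_(i < N) k%:R ^+ 2)%:E x))%E).
  apply: ge0_le_integral => //=.
  - by move=> x _; rewrite lee_fin sqnorm_ge0.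
  - by apply/measurable_EFinP/measurable_sqnorm; exact: measurable_clipv.
  - move=> x _; rewrite lee_fin; apply: ler_sum => i _.
    by rewrite mxE clip_bound.
by rewrite integral_cst//= probability_setT mule1 ltry.
Qed.

Lemma L2_dense_sums_borel :
  L2_dense_sums P12 (@measurable_fun _ _ 'rV[R]_M1 'rV[R]_N setT)
    (@measurable_fun _ _ 'rV[R]_M2 'rV[R]_N setT).
Proof.
move=> _ [phi mphi [psi mpsi <-]] rho2 e e0.
pose g (k : nat) (x : X12) : R := sqnorm (phi x.1 + psi x.2 -
  (clipv k (phi x.1) + clipv k (psi x.2))).
have mg k : measurable_fun setT (g k).
  apply: measurable_sqnorm; apply/measurable_rVP => i.
  have /measurable_rVP/(_ i) m1 := measurable_sum_space mphi mpsi.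
  have /measurable_rVP/(_ i) m2 := measurable_sum_space
    (measurable_clipv k mphi) (measurable_clipv k mpsi).
  apply: (eq_measurable_fun (fun x : X12 => (phi x.1 + psi x.2) ord0 i -
     ((clipv k \o phi) x.1 + (clipv k \o psi) x.2) ord0 i)).
    by move=> x _; rewrite !mxE.
  exact: measurable_funB.
have := @dominated_convergence _ _ R P12 setT measurableT
  (fun k x => (g k x)%:E) (cst 0%E)
  (fun x => (sqnorm (phi x.1 + psi x.2))%:E).
case.
- by move=> k; exact/measurable_EFinP.
- exact: measurable_cst.
- apply: aeW => x _; apply: cvg_near_cst.
  pose K := \sum_i (`|phi x.1 ord0 i| + `|psi x.2 ord0 i|).
  near=> k; rewrite /g /sqnorm big1// => i _; rewrite !mxE.
  have Kk : K <= k%:R by near: k; exact: nbhs_infty_ger.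
  have iK : `|phi x.1 ord0 i| + `|psi x.2 ord0 i| <= K.
    by rewrite /K (bigD1 i)//= lerDl sumr_ge0// => j _; rewrite addr_ge0.
  rewrite !clip_id ?subrr ?expr0n//.
    by apply: le_trans (le_trans iK Kk); rewrite lerDr.
  by apply: le_trans (le_trans iK Kk); rewrite lerDl.
- apply/integrableP; split.
    by apply/measurable_EFinP/measurable_sqnorm; exact: measurable_sum_space.
  rewrite (eq_integral (fun x : X12 => (sqnorm (phi x.1 + psi x.2))%:E)).
    by move: rho2; rewrite /square_integrable unlock.
  by move=> x _ /=; rewrite ger0_norm// sqnorm_ge0.
- apply: aeW => x k _; rewrite gee0_abs ?lee_fin ?sqnorm_ge0//.
  by apply: ler_sum => i _; rewrite !mxE clip_addB.
move=> _ _; rewrite integral_cst//= mul0e => cvg0.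
have : \forall k \near \oo, ((\int[P12]_x (g k x)%:E) < e%:E)%E.
  move: cvg0 => /(_ [set y | (y < e%:E)%E]); apply.
  by apply: (@open_nbhs_nbhs (\bar R)); split; [exact: open_ereal_lt_ereal|rewrite /= lte_fin].
move=> [k _ /(_ k (leqnn k))] /= gk.
exists (clipv k \o phi), (clipv k \o psi); split.
- split; first exact: measurable_clipv.
  by rewrite -compA; apply: square_integrable_clipv; exact: measurable_fst_comp.
- split; first exact: measurable_clipv.
  by rewrite -compA; apply: square_integrable_clipv; exact: measurable_snd_comp.
- by rewrite unlock.
Unshelve. all: by end_near.
Qed.

End borel.

(* Main.v *)
(* Write <., .> for the L2 inner product.  Stationarity of [phiA] and [psiB]
   fixes <Y, phi> for phi in A and <Y, psi> for psi in B, hence, by density,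
   <Y, rho> for every square-integrable rho in C: on C, the mean-square error is
   the same function c - 2 <Y, rho> + <rho, rho> for all admissible
   distributions, and its minimizer is unique almost surely.  For the minimax
   property, reflect Y through the estimator: (X, 2 rhoC(X) - Y) has the same
   mean-square errors on C as (X, Y), so its law is again admissible, and by the
   parallelogram law the errors of an arbitrary rho under both laws average to
   MSE(rhoC) + E |rhoC - rho|^2. *)
From HB Require Import structures.
Require Import Defs.
From mathcomp Require Import all_boot all_order all_algebra.
From mathcomp Require Import all_classical all_reals all_analysis.
From mathcomp Require Import measurable_realfun ring lra.

Import Order.TTheory GRing.Theory Num.Theory.

Local Open Scope classical_set_scope.
Local Open Scope ring_scope.

(** Serves twice: for Cauchy-Schwarz, and with [a = 0] for the normal equations, where it forces
    [b = 0]. *)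
Lemma quadratic_ge0_discr (R : realFieldType) (a b c : R) :
  0 <= c -> (forall t, 0 <= a + 2 * t * b + t ^+ 2 * c) -> b ^+ 2 <= a * c.
Proof.
rewrite le_eqVlt => /predU1P[<- h|c0 h].
  have [->|b0] := eqVneq b 0; first by rewrite mulr0 expr0n.
  (* When [c = 0] the polynomial is affine in [t]; this [t] gives it the value -1. *)
  have := h (- (a + 1) / (2 * b)).
  suff -> : a + 2 * (- (a + 1) / (2 * b)) * b +
    (- (a + 1) / (2 * b)) ^+ 2 * 0 = -1 by rewrite lerNr oppr0 ler10.
  by field; rewrite b0.
(* The minimizer of the polynomial when [c > 0]. *)
have := h (- b / c); rewrite -(pmulr_rge0 _ c0).
suff -> : c * (a + 2 * (- b / c) * b + (- b / c) ^+ 2 * c) = a * c - b ^+ 2.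
  by rewrite subr_ge0.
by field; rewrite gt_eqF.
Qed.

(** * Euclidean inner product of row vectors *)

Definition dotv {R : realType} {n : nat} (u v : 'rV[R]_n) : R :=
  \sum_(i < n) u ord0 i * v ord0 i.

Section dotv.
Set Implicit Arguments.
Unset Strict Implicit.
Context {R : realType} {n : nat}.
Implicit Types u v w : 'rV[R]_n.

Lemma dotvC u v : dotv u v = dotv v u.
Proof. by apply: eq_bigr => i _; rewrite mulrC. Qed.

Lemma dotvv u : dotv u u = sqnorm u.
Proof. by apply: eq_bigr => i _; rewrite expr2. Qed.

Lemma dotv_linearl a u v w : dotv (a *: u + v) w = a * dotv u w + dotv v w.
Proof.
rewrite /dotv mulr_sumr -big_split; apply: eq_bigr => i _ /=.
by rewrite !mxE mulrDl mulrA.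
Qed.

(** A crude bound, enough to make the pointwise inner product of square-integrable functions
    integrable. *)
Lemma normr_dotv_le u v : `|dotv u v| <= sqnorm u + sqnorm v.
Proof.
rewrite /dotv /sqnorm -big_split; apply: le_trans (ler_norm_sum _ _ _) _.
apply: ler_sum => i _ /=; move: (u _ _) (v _ _) => a b.
by rewrite ler_norml; apply/andP; split; nra.
Qed.

Lemma sqnorm0_eq0 u : sqnorm u = 0 -> u = 0.
Proof.
move=> /psumr_eq0P u0; apply/rowP => i; rewrite mxE; apply/eqP.
by rewrite -sqrf_eq0 u0// => j _; rewrite sqr_ge0.
Qed.

Lemma sqnormN u : sqnorm (- u) = sqnorm u.
Proof. by apply: eq_bigr => i _; rewrite mxE sqrrN. Qed.

Lemma sqnorm_linear_le a u v :
  sqnorm (a *: u + v) <= 2 * (a ^+ 2 * sqnorm u + sqnorm v).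
Proof.
rewrite -{1}[v]opprK -(sqnormN v); apply: le_trans (sqnormB_le _ _) _.
suff -> : sqnorm (a *: u) = a ^+ 2 * sqnorm u by [].
by rewrite /sqnorm mulr_sumr; apply: eq_bigr => i _; rewrite mxE exprMn.
Qed.

(** The parallelogram law for [y - r] and [r - u]: their sum is [y - u], and [2 *: r - y - u] is
    [r - u] minus [y - r]. *)
Lemma sqnorm_reflection y r u :
  sqnorm (y - u) + sqnorm (2 *: r - y - u) =
  2 * sqnorm (y - r) + 2 * sqnorm (r - u).
Proof.
rewrite /sqnorm !mulr_sumr -!big_split; apply: eq_bigr => i _ /=.
by rewrite !mxE; ring.
Qed.

End dotv.

(** * The L2 inner product of vector-valued functions on a probability space *)

Section square_integrable_vectors.
Set Implicit Arguments.
Unset Strict Implicit.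
Context d (T : measurableType d) (R : realType) (Q : probability T R) (n : nat).
Implicit Types f g h : T -> 'rV[R]_n.

Definition L2 f : Prop :=
  measurable_fun setT f /\ ('E_Q[fun x => sqnorm (f x)] < +oo)%E.

(** The real-valued integral sends infinite values to a default, so the algebraic rules below ask
    for members of [L2]. *)
Definition ip f g : R := \int[Q]_x dotv (f x) (g x).

Lemma measurable_linear a f g : measurable_fun setT f ->
  measurable_fun setT g -> measurable_fun setT (a *: f + g).
Proof.
move=> /measurable_rVP mf /measurable_rVP mg; apply/measurable_rVP => i.
apply: (eq_measurable_fun (fun x => a * f x ord0 i + g x ord0 i)).
  by move=> x _; rewrite !mxE.
by apply: measurable_funD => //; exact: measurable_funM.
Qed.

Lemma measurable_dotv f g : measurable_fun setT f ->
  measurable_fun setT g -> measurable_fun setT (fun x => dotv (f x) (g x)).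
Proof.
move=> /measurable_rVP mf /measurable_rVP mg.
by apply: measurable_sum => i; exact: measurable_funM.
Qed.

Lemma integrable_sqnorm {f} : L2 f ->
  Q.-integrable setT (EFin \o (fun x => sqnorm (f x))).
Proof.
move=> [mf f2]; apply/integrableP; split.
  by apply/measurable_EFinP; exact: measurable_sqnorm.
move: f2; rewrite unlock; under [X in _ -> (X < _)%E]eq_integral => x _.
  rewrite gee0_abs ?lee_fin ?sqnorm_ge0//; over.
by [].
Qed.

Lemma L2_linear a f g : L2 f -> L2 g -> L2 (a *: f + g).
Proof.
move=> f2 g2; have mfg := measurable_linear a f2.1 g2.1; split=> //.
rewrite unlock.
pose h x : \bar R :=
  (2%:E * ((a ^+ 2)%:E * (sqnorm (f x))%:E + (sqnorm (g x))%:E))%E.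
have ih : Q.-integrable setT h.
  apply: integrableZl => //; apply: integrableD => //.
    by apply: integrableZl => //; exact: integrable_sqnorm.
  exact: integrable_sqnorm.
apply: (@le_lt_trans _ _ (\int[Q]_x h x)%E).
  apply: ge0_le_integral => //=.
  - by move=> x _; rewrite lee_fin sqnorm_ge0.
  - by apply/measurable_EFinP; exact: measurable_sqnorm.
  - by apply: measurable_int; exact: ih.
  - by move=> x _; rewrite lee_fin sqnorm_linear_le.
by have := integral_fune_lt_pinfty measurableT ih.
Qed.

Lemma L2D f g : L2 f -> L2 g -> L2 (f + g).
Proof. by move=> f2 g2; rewrite -[f]scale1r; exact: L2_linear. Qed.

Lemma L2B f g : L2 f -> L2 g -> L2 (f - g).
Proof. by move=> f2 g2; rewrite addrC -scaleN1r; exact: L2_linear. Qed.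

Lemma integrable_dotv {f g} : L2 f -> L2 g ->
  Q.-integrable setT (EFin \o (fun x => dotv (f x) (g x))).
Proof.
move=> f2 g2; apply: (le_integrable measurableT
  (g := ((EFin \o (fun x => sqnorm (f x))) \+
        (EFin \o (fun x => sqnorm (g x))))%E)).
- by apply/measurable_EFinP; exact: measurable_dotv f2.1 g2.1.
- move=> x _ /=; rewrite lee_fin (le_trans (normr_dotv_le _ _))//.
  exact: ler_norm.
- by apply: integrableD => //; exact: integrable_sqnorm.
Qed.

Lemma ipC f g : ip f g = ip g f.
Proof. by apply: eq_Rintegral => x _; rewrite dotvC. Qed.

Lemma ip_linearl a f g h : L2 f -> L2 g -> L2 h ->
  ip (a *: f + g) h = a * ip f h + ip g h.
Proof.
move=> f2 g2 h2; rewrite /ip -RintegralZl//; last exact: integrable_dotv.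
rewrite -RintegralD//; last 2 first.
- exact: (integrableZl measurableT a (integrable_dotv f2 h2)).
- exact: integrable_dotv.
by apply: eq_Rintegral => x _; rewrite dotv_linearl.
Qed.

Lemma ip_linearr a f g h : L2 f -> L2 g -> L2 h ->
  ip h (a *: f + g) = a * ip h f + ip h g.
Proof. by move=> f2 g2 h2; rewrite ipC ip_linearl// !(ipC h). Qed.

Lemma ipDr f g h : L2 f -> L2 g -> L2 h -> ip h (f + g) = ip h f + ip h g.
Proof. by move=> *; rewrite -[f]scale1r ip_linearr// scale1r mul1r. Qed.

Lemma ipBl f g h : L2 f -> L2 g -> L2 h -> ip (f - g) h = ip f h - ip g h.
Proof. by move=> *; rewrite addrC -scaleN1r ip_linearl// mulN1r addrC. Qed.

Lemma ipBr f g h : L2 f -> L2 g -> L2 h -> ip h (f - g) = ip h f - ip h g.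
Proof. by move=> *; rewrite ipC ipBl// !(ipC h). Qed.

Lemma ip_ge0 f : 0 <= ip f f.
Proof. by apply: Rintegral_ge0 => x _; rewrite dotvv sqnorm_ge0. Qed.

Lemma expectation_sqnorm f : L2 f ->
  'E_Q[fun x => sqnorm (f x)]%E = (ip f f)%:E.
Proof.
move=> f2; rewrite unlock /ip /Rintegral fineK.
  by apply: eq_integral => x _; rewrite dotvv.
apply: integrable_fin_num => //; exact: integrable_dotv.
Qed.

Lemma ip_linear_sq a f g : L2 f -> L2 g ->
  ip (a *: f + g) (a *: f + g) = ip g g + 2 * a * ip f g + a ^+ 2 * ip f f.
Proof.
move=> f2 g2; rewrite ip_linearl ?ip_linearr//; try exact: L2_linear.
by rewrite (ipC g f); ring.
Qed.

Lemma ipB_sq f g : L2 f -> L2 g ->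
  ip (f - g) (f - g) = ip f f - 2 * ip f g + ip g g.
Proof.
by move=> f2 g2; rewrite addrC -scaleN1r ip_linear_sq// (ipC g f); ring.
Qed.

(** The squared norm of [t *: f + g] is a quadratic polynomial in [t] without negative values. *)
Lemma cauchy_schwarz f g : L2 f -> L2 g -> ip f g ^+ 2 <= ip f f * ip g g.
Proof.
move=> f2 g2; rewrite mulrC; apply: quadratic_ge0_discr => [|t].
  exact: ip_ge0.
by rewrite -ip_linear_sq// ip_ge0.
Qed.

Lemma expectation_sqnorm_eq0 f : measurable_fun setT f ->
  'E_Q[fun x => sqnorm (f x)]%E = 0%E -> {ae Q, forall x, f x = 0}.
Proof.
move=> mf; rewrite unlock => f0.
have msf : measurable_fun setT (fun x => (sqnorm (f x))%:E).
  by apply/measurable_EFinP; exact: measurable_sqnorm.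
have : ae_eq Q setT (fun x => (sqnorm (f x))%:E) (cst 0%E).
  apply/ae_eq_integral_abs => //; rewrite -[RHS]f0.
  by apply: eq_integral => x _; rewrite gee0_abs// lee_fin sqnorm_ge0.
by apply: filterS => x /(_ I) /= [] /sqnorm0_eq0.
Qed.

End square_integrable_vectors.
Arguments L2 {d T R} Q {n} f.
Arguments ip {d T R} Q {n} f g.

(** * Least squares over a linear space of estimators, under a joint law with given marginal and
    second moment *)

Section couplings.
Set Implicit Arguments.
Unset Strict Implicit.
Context {R : realType} {M1 M2 N : nat}.
Local Notation X12 := ('rV[R]_M1 * 'rV[R]_M2)%type.
Local Notation XY := ('rV[R]_M1 * 'rV[R]_M2 * 'rV[R]_N)%type.
Context (P12 : probability X12 R) (c : R).
Implicit Types (Q : probability XY R) (rho sigma : X12 -> 'rV[R]_N).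

Local Notation Y := (@snd X12 'rV[R]_N).

Definition has_marginal Q : Prop :=
  forall S : set X12, measurable S -> pushforward Q fst S = P12 S.

(** Conditions (iii) and (iv) of admissibility alone. The least-squares theory rests on these, and
    so applies to [A], [B] and their sum alike. *)
Definition coupling Q : Prop :=
  has_marginal Q /\ 'E_Q[fun w : XY => sqnorm w.2]%E = c%:E.

Lemma expectation_marginal Q (h : X12 -> R) : has_marginal Q ->
  measurable_fun setT h -> (forall x, 0 <= h x) ->
  'E_Q[fun w : XY => h w.1]%E = 'E_P12[h]%E.
Proof.
move=> QP mh h0; rewrite unlock.
have -> : (\int[P12]_x (h x)%:E = \int[pushforward Q fst]_x (h x)%:E)%E.
  by apply: eq_measure_integral => S mS _; exact: esym (QP S mS).
rewrite ge0_integral_pushforward//; first exact/measurable_EFinP.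
by move=> x _; rewrite lee_fin.
Qed.

Lemma measurable_estimator rho : measurable_fun setT rho ->
  measurable_fun setT (fun w : XY => rho w.1).
Proof. by move=> mrho; exact: measurableT_comp. Qed.

Lemma L2_marginal Q rho : has_marginal Q -> L2 P12 rho -> L2 Q (rho \o fst).
Proof.
move=> QP [mrho rho2]; split; first exact: measurable_estimator.
rewrite (expectation_marginal (h := fun x => sqnorm (rho x)))//.
  exact: measurable_sqnorm.
by move=> x; exact: sqnorm_ge0.
Qed.

Lemma ip_marginal Q rho : has_marginal Q -> L2 P12 rho ->
  ip Q (rho \o fst) (rho \o fst) = ip P12 rho rho.
Proof.
move=> QP rho2; apply: EFin_inj.
rewrite -!expectation_sqnorm//; last exact: L2_marginal.
rewrite (expectation_marginal (h := fun x => sqnorm (rho x)))//.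
  by apply: measurable_sqnorm; exact: rho2.1.
by move=> x; exact: sqnorm_ge0.
Qed.

Lemma L2_snd Q : coupling Q -> L2 Q Y.
Proof. by move=> [_ Yc]; split=> //; rewrite Yc ltry. Qed.

Lemma ip_snd_snd Q : coupling Q -> ip Q Y Y = c.
Proof.
by move=> QP; apply: EFin_inj; rewrite -expectation_sqnorm ?QP.2//;
  exact: L2_snd.
Qed.

Lemma measurable_error rho : measurable_fun setT rho ->
  measurable_fun setT (fun w : XY => w.2 - rho w.1).
Proof.
move=> mrho.
rewrite (_ : (fun _ => _) = -1 *: (rho \o fst) + Y).
  by apply: measurable_linear => //; exact: measurable_estimator.
by apply/funext => w; rewrite addrC scaleN1r.
Qed.

(** The law [Q] enters the error only through the correlation of [Y] with the estimator. *)
Lemma MSE_fin Q rho : coupling Q -> L2 P12 rho ->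
  MSE Q rho = (c - 2 * ip Q Y (rho \o fst) + ip P12 rho rho)%:E.
Proof.
move=> QP rho2; have Y2 := L2_snd QP; have rho2' := L2_marginal QP.1 rho2.
have := expectation_sqnorm (L2B Y2 rho2').
rewrite ipB_sq// ip_snd_snd// ip_marginal//; last exact: QP.1.
Qed.

(** The estimator is [Y] minus the error, a difference of two square-integrable functions. *)
Lemma MSE_lt_pinfty_L2 Q rho : coupling Q -> measurable_fun setT rho ->
  (MSE Q rho < +oo)%E -> L2 P12 rho.
Proof.
move=> QP mrho rhoQ; split=> //.
have /(L2B (L2_snd QP)) : L2 Q (Y - (rho \o fst)).
  by split => //; exact: measurable_error.
rewrite subKr => -[_].
rewrite (expectation_marginal (h := fun x => sqnorm (rho x)))//;
  first exact: QP.1.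
  exact: measurable_sqnorm.
by move=> x; exact: sqnorm_ge0.
Qed.

(** If [rho] is not square-integrable, both errors are infinite, so only the square-integrable case
    needs equal correlations. *)
Lemma eq_MSE Q Q' rho : coupling Q -> coupling Q' -> measurable_fun setT rho ->
  (L2 P12 rho -> ip Q Y (rho \o fst) = ip Q' Y (rho \o fst)) ->
  MSE Q rho = MSE Q' rho.
Proof.
move=> QP QP' mrho eqip.
have [rho2|rhoN2] := pselect (L2 P12 rho); first by rewrite !MSE_fin ?eqip.
have inf (Q0 : probability XY R) : coupling Q0 -> MSE Q0 rho = +oo%E.
  move=> QP0; apply/eqP; rewrite -leye_eq leNgt; apply/negP => ?.
  by apply: rhoN2; exact: MSE_lt_pinfty_L2 QP0 _ _.
by rewrite !inf.
Qed.

Lemma ae_eq_MSE Q rho sigma : coupling Q -> measurable_fun setT rho ->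
  measurable_fun setT sigma -> rho = sigma %[ae P12] ->
  MSE Q rho = MSE Q sigma.
Proof.
move=> [QP _] mrho msigma [S [mS S0 subS]]; rewrite /MSE unlock.
apply: ge0_ae_eq_integral => //.
- by apply/measurable_EFinP; apply: measurable_sqnorm; exact: measurable_error.
- by apply/measurable_EFinP; apply: measurable_sqnorm; exact: measurable_error.
- by move=> x _; rewrite lee_fin sqnorm_ge0.
- by move=> x _; rewrite lee_fin sqnorm_ge0.
(* The exceptional set, pulled back to the joint space, is null for [Q] because the marginal of [Q]
   is [P12]. *)
exists (fst @^-1` S); split.
- by rewrite -[X in measurable X]setTI; exact: measurable_fst.
- by have := QP _ mS; rewrite S0.
- move=> w /= neq; apply: subS => /= eq; apply: neq => _.
  by rewrite eq.
Qed.

Definition linear_space (D : set (X12 -> 'rV[R]_N)) : Prop :=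
  [/\ D `<=` measurable_fun setT, D 0 &
      forall a rho sigma, D rho -> D sigma -> D (a *: rho + sigma)].

(** The zero estimator lies in [D] and has finite error [c], so a minimizer has finite error too. *)
Lemma argmin_L2 Q D sigma : coupling Q -> linear_space D ->
  argmin D (MSE Q) sigma -> L2 P12 sigma.
Proof.
move=> QP [mD D0 Dlin] [Dsigma minsigma].
apply: (MSE_lt_pinfty_L2 QP (mD _ Dsigma)).
apply: (le_lt_trans (minsigma _ D0)).
rewrite (_ : MSE Q 0 = c%:E) ?ltry// -QP.2.
by congr expectation; apply/funext => w; rewrite subr0.
Qed.

(** Perturbing [sigma] to [t *: rho + sigma] changes the error by a quadratic polynomial in [t] with
    zero constant term. It is nonnegative by minimality, so its linear coefficient vanishes. *)
Lemma normal_equations Q D sigma rho : coupling Q -> linear_space D ->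
  argmin D (MSE Q) sigma -> D rho -> L2 P12 rho ->
  ip Q Y (rho \o fst) = ip P12 sigma rho.
Proof.
move=> QP linD sigmamin Drho rho2.
have sigma2 := argmin_L2 QP linD sigmamin.
have [mD D0 Dlin] := linD; have [Dsigma minsigma] := sigmamin.
have Y2 := L2_snd QP; have rho2' := L2_marginal QP.1 rho2.
have sigma2' := L2_marginal QP.1 sigma2.
suff : (ip P12 rho sigma - ip Q Y (rho \o fst)) ^+ 2 <= 0 * ip P12 rho rho.
  rewrite mul0r (ipC _ rho) => h; apply/eqP.
  by rewrite eq_sym -subr_eq0 -sqrf_eq0 eq_le h sqr_ge0.
apply: quadratic_ge0_discr => [|t]; first exact: ip_ge0.
have := minsigma _ (Dlin t _ _ Drho Dsigma).
rewrite !MSE_fin//; last exact: L2_linear.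
rewrite lee_fin (_ : (_ + _) \o fst = t *: (rho \o fst) + (sigma \o fst))//.
rewrite ip_linearr// ip_linear_sq//.
by move: (ip _ _ _) (ip _ _ _) (ip _ _ _) (ip _ _ _) (ip _ _ _) => *; nra.
Qed.

(** The normal equations, applied to both [rho] and [sigma], cancel the cross term. *)
Lemma MSE_pythagoras Q D sigma rho : coupling Q -> linear_space D ->
  argmin D (MSE Q) sigma -> D rho -> L2 P12 rho ->
  MSE Q rho = (MSE Q sigma + (ip P12 (sigma - rho) (sigma - rho))%:E)%E.
Proof.
move=> QP linD sigmamin Drho rho2.
have sigma2 := argmin_L2 QP linD sigmamin.
rewrite !MSE_fin// !(normal_equations QP linD sigmamin)//;
  last exact: sigmamin.1.
by rewrite ipB_sq// -EFinD; congr EFin; ring.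
Qed.

(** Two minimizers have the same finite error, so the excess in the Pythagorean identity is zero. *)
Lemma argmin_unique Q D sigma rho : coupling Q -> linear_space D ->
  argmin D (MSE Q) sigma -> argmin D (MSE Q) rho -> rho = sigma %[ae P12].
Proof.
move=> QP linD sigmamin rhomin.
have sigma2 := argmin_L2 QP linD sigmamin.
have rho2 := argmin_L2 QP linD rhomin.
have := MSE_pythagoras QP linD sigmamin rhomin.1 rho2.
have := rhomin.2 _ sigmamin.1.
rewrite (MSE_fin QP sigma2) => + E; rewrite {}E -EFinD lee_fin gerDl => q0.
have q0' : ip P12 (sigma - rho) (sigma - rho) = 0.
  by apply/eqP; rewrite eq_le q0 ip_ge0.
have mB : measurable_fun setT (sigma - rho) by have [] := L2B sigma2 rho2.
have := @expectation_sqnorm_eq0 _ _ _ P12 _ _ mB.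
rewrite expectation_sqnorm ?q0'; last exact: L2B.
move=> /(_ erefl); apply: filterS => x /eqP + _.
by rewrite subr_eq0 => /eqP ->.
Qed.

(** * Reflecting [Y] through an estimator *)

Section reflection.
Context (Q : probability XY R) (sigma : X12 -> 'rV[R]_N).
Hypothesis msigma : measurable_fun setT sigma.

Definition reflect (w : XY) : XY := (w.1, 2 *: sigma w.1 - w.2).

Lemma measurable_reflect : measurable_fun setT reflect.
Proof.
apply/measurable_fun_pairP; split; first exact: measurable_fst.
rewrite (_ : _ \o _ = 2 *: (sigma \o fst) + (-1 *: Y + 0)).
  apply: measurable_linear; first exact: measurable_estimator.
  by apply: measurable_linear => //; exact: measurable_cst.
by apply/funext => w; rewrite /= addr0 scaleN1r.
Qed.

HB.instance Definition _ :=
  isMeasurableFun.Build _ _ _ _ reflect measurable_reflect.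

Definition reflection : probability XY R :=
  distribution Q (reflect : {mfun XY >-> XY}).

Lemma expectation_reflection (h : XY -> R) : measurable_fun setT h ->
  (forall w, 0 <= h w) ->
  'E_reflection[h]%E = 'E_Q[h \o reflect]%E.
Proof.
move=> mh h0; rewrite unlock /reflection ge0_integral_distribution//.
exact/measurable_EFinP.
Qed.

(** The integral of [sqnorm_reflection]. All terms are nonnegative, so it holds in the extended
    reals for every measurable [rho]. *)
Lemma MSE_reflection rho : has_marginal Q -> measurable_fun setT rho ->
  (MSE Q rho + MSE reflection rho =
   2%:E * (MSE Q sigma + 'E_P12[fun x => sqnorm (sigma x - rho x)]))%E.
Proof.
move=> QP mrho.
have mB : measurable_fun setT (fun x => sqnorm (sigma x - rho x)).
  apply: measurable_sqnorm; rewrite (_ : (fun _ => _) = -1 *: rho + sigma).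
    exact: measurable_linear.
  by apply/funext => x; rewrite addrC scaleN1r.
have merr (tau : X12 -> 'rV[R]_N) : measurable_fun setT tau ->
    measurable_fun setT (fun w : XY => (sqnorm (w.2 - tau w.1))%:E).
  move=> mtau; apply/measurable_EFinP; apply: measurable_sqnorm.
  exact: measurable_error.
have mB' : measurable_fun setT
    (fun w : XY => (sqnorm (sigma w.1 - rho w.1))%:E).
  by apply/measurable_EFinP; exact: (measurableT_comp mB).
rewrite {2}/MSE expectation_reflection; last 2 first.
- by apply: measurable_sqnorm; exact: measurable_error.
- by move=> w; exact: sqnorm_ge0.
rewrite -(expectation_marginal (h := fun x => sqnorm (sigma x - rho x)) QP)//;
  last by move=> x; exact: sqnorm_ge0.
rewrite /MSE unlock -ge0_integralD//; last 4 first.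
- by move=> w _; rewrite lee_fin sqnorm_ge0.
- exact: merr.
- by move=> w _; rewrite lee_fin sqnorm_ge0.
- apply: (measurableT_comp (merr rho mrho)); exact: measurable_reflect.
rewrite -ge0_integralD//; last 3 first.
- by move=> w _; rewrite lee_fin sqnorm_ge0.
- exact: merr.
- by move=> w _; rewrite lee_fin sqnorm_ge0.
rewrite -ge0_integralZl//; last 2 first.
- by apply: emeasurable_funD => //; exact: merr.
- by move=> w _; apply: adde_ge0; rewrite lee_fin sqnorm_ge0.
apply: eq_integral => w _; rewrite /= -!EFinD -EFinM; congr EFin.
by rewrite sqnorm_reflection mulrDr.
Qed.

Lemma has_marginal_reflection : has_marginal Q -> has_marginal reflection.
Proof. by []. Qed.

End reflection.

(** By the Pythagorean identity the two errors of [rho] sum to [2 * MSE Q rho], and the finite term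
    [MSE Q rho] cancels. *)
Lemma MSE_reflection_argmin Q D sigma (msigma : measurable_fun setT sigma) rho :
  coupling Q -> linear_space D -> argmin D (MSE Q) sigma -> D rho ->
  L2 P12 rho -> MSE (reflection Q msigma) rho = MSE Q rho.
Proof.
move=> QP linD sigmamin Drho rho2.
have sigma2 := argmin_L2 QP linD sigmamin.
have := MSE_reflection msigma QP.1 rho2.1.
rewrite (expectation_sqnorm (L2B sigma2 rho2)).
rewrite -(MSE_pythagoras QP linD sigmamin)//.
rewrite (MSE_fin QP rho2) mule_natl mule2n.
by case: (MSE (reflection _ _) _) => [r| |]//= [] /addrI ->.
Qed.

(** The second moment of [Y] is the error of the zero estimator, a member of [D], so reflection
    preserves it. *)
Lemma coupling_reflection Q D sigma (msigma : measurable_fun setT sigma) :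
  coupling Q -> linear_space D -> argmin D (MSE Q) sigma ->
  coupling (reflection Q msigma).
Proof.
move=> QP linD sigmamin; split; first by apply: has_marginal_reflection QP.1.
have MSE0 (Q0 : probability XY R) :
    'E_Q0[fun w : XY => sqnorm w.2]%E = MSE Q0 0.
  by congr expectation; apply/funext => w; rewrite subr0.
have [mD D0 _] := linD.
rewrite MSE0 (MSE_reflection_argmin _ QP linD)//; first by rewrite -MSE0 QP.2.
split; first exact: mD.
rewrite unlock (_ : (fun _ => _) = cst 0%E);
  first by rewrite integral_cst ?mul0e.
apply/funext => x /=; congr EFin.
by rewrite /sqnorm big1// => i _; rewrite mxE expr0n.
Qed.

Lemma eq_MSE_reflection Q D sigma (msigma : measurable_fun setT sigma) rho :
  coupling Q -> linear_space D -> argmin D (MSE Q) sigma -> D rho ->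
  MSE (reflection Q msigma) rho = MSE Q rho.
Proof.
move=> QP linD sigmamin Drho; have [mD _ _] := linD.
have QP' := coupling_reflection msigma QP linD sigmamin.
apply: eq_MSE => // rho2; first exact: mD.
have := MSE_reflection_argmin msigma QP linD sigmamin Drho rho2.
by rewrite !MSE_fin// => -[]; lra.
Qed.

End couplings.

(** * Admissible laws: invariance of errors on the sum space and the minimax lower bound *)

Section minimax.
Set Implicit Arguments.
Unset Strict Implicit.
Context {R : realType} {M1 M2 N : nat}.
Local Notation X12 := ('rV[R]_M1 * 'rV[R]_M2)%type.
Local Notation XY := ('rV[R]_M1 * 'rV[R]_M2 * 'rV[R]_N)%type.
Context (A : set ('rV[R]_M1 -> 'rV[R]_N)) (B : set ('rV[R]_M2 -> 'rV[R]_N)).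
Context (phiA : 'rV[R]_M1 -> 'rV[R]_N) (psiB : 'rV[R]_M2 -> 'rV[R]_N).
Context (P12 : probability X12 R) (c : R).
Hypothesis A_linear : GRing.submod_closed [pred phi | phi \in A].
Hypothesis B_linear : GRing.submod_closed [pred psi | psi \in B].
Hypothesis A_measurable : A `<=` measurable_fun setT.
Hypothesis B_measurable : B `<=` measurable_fun setT.
Hypothesis AB_L2 : L2_dense_sums P12 A B.
Implicit Types (P Q : probability XY R) (rho : X12 -> 'rV[R]_N).

Local Notation F := (admissible A B phiA psiB P12 c).
Local Notation C := (sum_space A B).
Local Notation Y := (@snd X12 'rV[R]_N).

Lemma submod_closed_set (V : lmodType R) (S : set V) :
  GRing.submod_closed [pred v | v \in S] ->
  S 0 /\ forall a u v, S u -> S v -> S (a *: u + v).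
Proof.
move=> [S0 Slin]; split; first exact: set_mem S0.
move=> a u v Su Sv; exact: set_mem (Slin a u v (mem_set Su) (mem_set Sv)).
Qed.

(** Views [A] as a space of functions of the pair, so that condition (i) becomes a least-squares
    problem of the kind treated above. *)
Lemma linear_space_fst :
  linear_space [set phi \o @fst _ 'rV[R]_M2 | phi in A].
Proof.
have [A0 Alin] := submod_closed_set A_linear; split.
- by move=> _ [phi Aphi <-]; apply: measurable_fst_comp; exact: A_measurable.
- by exists 0.
- move=> a _ _ [phi Aphi <-] [psi Apsi <-].
  by exists (a *: phi + psi) => //; exact: Alin.
Qed.

Lemma linear_space_snd :
  linear_space [set psi \o @snd 'rV[R]_M1 _ | psi in B].
Proof.
have [B0 Blin] := submod_closed_set B_linear; split.
- by move=> _ [psi Bpsi <-]; apply: measurable_snd_comp; exact: B_measurable.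
- by exists 0.
- move=> a _ _ [phi Bphi <-] [psi Bpsi <-].
  by exists (a *: phi + psi) => //; exact: Blin.
Qed.

Lemma linear_space_sum : linear_space C.
Proof.
have [A0 Alin] := submod_closed_set A_linear.
have [B0 Blin] := submod_closed_set B_linear; split.
- move=> _ [phi Aphi [psi Bpsi <-]].
  by apply: measurable_sum_space; [exact: A_measurable|exact: B_measurable].
- exists 0 => //; exists 0 => //.
  by apply/funext => x; rewrite /= addr0.
- move=> a _ _ [phi Aphi [psi Bpsi <-]] [phi' Aphi' [psi' Bpsi' <-]].
  exists (a *: phi + phi'); first exact: Alin.
  exists (a *: psi + psi'); first exact: Blin.
  apply/funext => x.
  rewrite -[RHS]/(a *: (phi x.1 + psi x.2) + (phi' x.1 + psi' x.2)).
  by rewrite scalerDr addrACA.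
Qed.

Lemma sum_space_fst phi : A phi -> C (phi \o fst).
Proof.
move=> Aphi; exists phi => //; exists 0.
  by have [] := submod_closed_set B_linear.
by apply/funext => x; rewrite /= addr0.
Qed.

Lemma sum_space_snd psi : B psi -> C (psi \o snd).
Proof.
move=> Bpsi; exists 0; first by have [] := submod_closed_set A_linear.
by exists psi => //; apply/funext => x; rewrite /= add0r.
Qed.

Lemma admissible_coupling Q : F Q -> coupling P12 c Q.
Proof. by case=> _ _ QP Qc; split. Qed.

Lemma admissible_argmin_fst Q : F Q ->
  argmin [set phi \o @fst _ 'rV[R]_M2 | phi in A] (MSE Q) (phiA \o fst).
Proof.
case=> -[AphiA minA] _ _ _; split; first by exists phiA.
by move=> _ [phi Aphi <-]; exact: minA.
Qed.

Lemma admissible_argmin_snd Q : F Q ->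
  argmin [set psi \o @snd 'rV[R]_M1 _ | psi in B] (MSE Q) (psiB \o snd).
Proof.
case=> _ [BpsiB minB] _ _; split; first by exists psiB.
by move=> _ [psi Bpsi <-]; exact: minB.
Qed.

(* On square-integrable summands both correlations are given by the normal
   equations for [phiA] and [psiB]; Cauchy-Schwarz extends the equality to
   mean-square limits of such sums. *)
Lemma ip_snd_admissible P Q rho : F P -> F Q -> C rho -> L2 P12 rho ->
  ip P Y (rho \o fst) = ip Q Y (rho \o fst).
Proof.
move=> FP FQ Crho rho2; apply/eqP; rewrite -subr_eq0; apply/negPn/negP => d0.
set delta := _ - _ in d0.
have d2 : 0 < delta ^+ 2 by rewrite exprn_even_gt0.
have PP := admissible_coupling FP; have QP := admissible_coupling FQ.
have c0 : 0 <= c by rewrite -(ip_snd_snd PP) ip_ge0.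
(* Under each law the correlation with [rho] is off from the common correlation [s] with the
   approximant by at most [c * e] in square. Hence [delta ^+ 2] is at most [4 * c * e], which is
   less than [4 * (c + 1) * e], that is, [delta ^+ 2] itself. *)
pose e := delta ^+ 2 / (4 * (c + 1)).
have e0 : 0 < e by rewrite divr_gt0//; lra.
have [phi [psi [[Aphi phi2] [Bpsi psi2]]]] := AB_L2 Crho rho2.2 e0.
set sigma : X12 -> 'rV[R]_N := (phi \o fst) + (psi \o snd).
have {}phi2 : L2 P12 (phi \o fst).
  by split=> //; apply: measurable_fst_comp; exact: A_measurable.
have {}psi2 : L2 P12 (psi \o snd).
  by split=> //; apply: measurable_snd_comp; exact: B_measurable.
have sigma2 : L2 P12 sigma by exact: L2D.
rewrite -[X in 'E_P12[X]%E]/(fun x => sqnorm ((rho - sigma) x)).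
rewrite expectation_sqnorm ?lte_fin; last exact: L2B.
move=> rho_sigma.
have ip_sigma Q0 : F Q0 -> ip Q0 Y (sigma \o fst) =
    ip P12 (phiA \o fst) (phi \o fst) + ip P12 (psiB \o snd) (psi \o snd).
  move=> FQ0; have QP0 := admissible_coupling FQ0.
  rewrite (_ : sigma \o fst = ((phi \o fst) \o fst) + ((psi \o snd) \o fst))//.
  rewrite ipDr; [|exact: L2_marginal QP0.1 _|exact: L2_marginal QP0.1 _|
    exact: L2_snd QP0].
  congr (_ + _).
    apply: (normal_equations QP0 linear_space_fst) => //.
      exact: admissible_argmin_fst.
    by exists phi.
  apply: (normal_equations QP0 linear_space_snd) => //.
    exact: admissible_argmin_snd.
  by exists psi.
have ip_le Q0 : F Q0 -> ip Q0 Y ((rho - sigma) \o fst) ^+ 2 <= c * e.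
  move=> FQ0; have QP0 := admissible_coupling FQ0.
  have rs2 := L2B rho2 sigma2.
  apply: le_trans (cauchy_schwarz (L2_snd QP0) (L2_marginal QP0.1 rs2)) _.
  by rewrite (ip_snd_snd QP0) (ip_marginal QP0.1)// ler_wpM2l// ltW.
have ipB Q0 : F Q0 -> ip Q0 Y ((rho - sigma) \o fst) =
    ip Q0 Y (rho \o fst) - ip Q0 Y (sigma \o fst).
  move=> FQ0; have QP0 := admissible_coupling FQ0.
  rewrite (_ : (_ - _) \o fst = (rho \o fst) - (sigma \o fst))//.
  rewrite ipBr//; [exact: L2_marginal QP0.1 _|exact: L2_marginal QP0.1 _|
    exact: L2_snd QP0].
have := ip_le _ FP; have := ip_le _ FQ; rewrite !ipB// !ip_sigma//.
move: (_ + ip P12 _ _) => s.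
have ce : (c + 1) * e = delta ^+ 2 / 4 by rewrite /e; field; lra.
move: d2 ce; rewrite /delta; move: (ip P _ _) (ip Q _ _) => p q d2 ce hq hp.
have : (p - q) ^+ 2 <= 2 * (p - s) ^+ 2 + 2 * (q - s) ^+ 2.
  by have := sqr_ge0 (p + q - 2 * s); nra.
by lra.
Qed.

Lemma MSE_admissible P Q rho : F P -> F Q -> C rho -> MSE P rho = MSE Q rho.
Proof.
move=> FP FQ Crho; have [mC _ _] := linear_space_sum.
apply: (eq_MSE (admissible_coupling FP) (admissible_coupling FQ)).
  exact: mC.
by move=> rho2; exact: ip_snd_admissible.
Qed.

Lemma argmin_admissible P Q : F P -> F Q ->
  argmin C (MSE P) `<=` argmin C (MSE Q).
Proof.
move=> FP FQ rho [Crho rhomin]; split=> // sigma Csigma.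
by rewrite -!(MSE_admissible FP FQ)//; exact: rhomin.
Qed.

(** Conditions (i) and (ii) compare errors of estimators that lie in [C], and reflection through
    [rhoC] leaves these errors unchanged. *)
Lemma admissible_reflection P rhoC (mrhoC : measurable_fun setT rhoC) :
  F P -> argmin C (MSE P) rhoC -> F (reflection P mrhoC).
Proof.
move=> FP rhoCmin; have PP := admissible_coupling FP.
have [QP Qc] := coupling_reflection mrhoC PP linear_space_sum rhoCmin.
have eqMSE := eq_MSE_reflection mrhoC PP linear_space_sum rhoCmin.
have [[AphiA minA] [BpsiB minB] _ _] := FP.
split => //; split=> //.
- move=> phi Aphi.
  have := minA _ Aphi; rewrite -[X in (X <= _)%E]/(MSE P (phiA \o fst)).
  rewrite -[X in (_ <= X)%E]/(MSE P (phi \o fst)).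
  by rewrite -!eqMSE//; exact: sum_space_fst.
- move=> psi Bpsi.
  have := minB _ Bpsi; rewrite -[X in (X <= _)%E]/(MSE P (psiB \o snd)).
  rewrite -[X in (_ <= X)%E]/(MSE P (psi \o snd)).
  by rewrite -!eqMSE//; exact: sum_space_snd.
Qed.

(** The supremum dominates the average of the errors under [P] and its reflection, and that average
    is the left-hand side. *)
Lemma worst_MSE_ge P rhoC rho : F P -> argmin C (MSE P) rhoC ->
  measurable_fun setT rho ->
  (MSE P rhoC + 'E_P12[fun x => sqnorm (rhoC x - rho x)] <=
   worst_MSE F rho)%E.
Proof.
move=> FP rhoCmin mrho; have PP := admissible_coupling FP.
have [mC _ _] := linear_space_sum; have mrhoC := mC _ rhoCmin.1.
have FP' := admissible_reflection mrhoC FP rhoCmin.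
rewrite -(@lee_pmul2l _ 2%:E)// -MSE_reflection//; last exact: PP.1.
by rewrite mule_natl mule2n; apply: leeD; apply: ereal_sup_ubound;
  [exists P|exists (reflection P mrhoC)].
Qed.

Lemma worst_MSE_sum_space P rho : F P -> C rho -> worst_MSE F rho = MSE P rho.
Proof.
move=> FP Crho; apply/eqP; rewrite eq_le; apply/andP; split.
  by apply: ge_ereal_sup => _ [Q FQ <-]; rewrite (MSE_admissible FQ FP).
by apply: ereal_sup_ubound; exists P.
Qed.

End minimax.

Theorem theorem4p1 (R : realType) (M1 M2 N : nat)
    (A : set ('rV[R]_M1 -> 'rV[R]_N)) (B : set ('rV[R]_M2 -> 'rV[R]_N))
    (phiA : 'rV[R]_M1 -> 'rV[R]_N) (psiB : 'rV[R]_M2 -> 'rV[R]_N)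
    (P12 : probability ('rV[R]_M1 * 'rV[R]_M2)%type R) (c : R)
    (A_linear : GRing.submod_closed [pred phi | phi \in A])
    (B_linear : GRing.submod_closed [pred psi | psi \in B])
    (A_measurable : A `<=` measurable_fun setT)
    (B_measurable : B `<=` measurable_fun setT)
    (AB_L2 : L2_dense_sums P12 A B)
    (c_gt0 : 0 < c)
    (P : probability ('rV[R]_M1 * 'rV[R]_M2 * 'rV[R]_N)%type R)
    (rhoC : 'rV[R]_M1 * 'rV[R]_M2 -> 'rV[R]_N) :
  let F := admissible A B phiA psiB P12 c in
  let C := sum_space A B in
  F P -> argmin C (MSE P) rhoC ->
  [/\ forall Q rho, F Q ->
        (argmin C (MSE Q) rho <-> C rho /\ rho = rhoC %[ae P12]),
      forall Q rho, F Q -> argmin C (MSE Q) rho -> MSE Q rho = MSE P rhoC &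
      forall rho, argmin (measurable_fun setT) (worst_MSE F) rho <->
        measurable_fun setT rho /\ rho = rhoC %[ae P12]].
Proof.

move=> F C FP rhoCmin.
have PP := admissible_coupling FP.
have linC : linear_space C by exact: linear_space_sum.
have [mC _ _] := linC; have mrhoC := mC _ rhoCmin.1.
have rhoC2 := argmin_L2 PP linC rhoCmin.
have argminP Q : F Q -> argmin C (MSE Q) `<=` argmin C (MSE P).
  by move=> FQ; apply: argmin_admissible FQ FP.
have argminQ Q : F Q -> argmin C (MSE P) `<=` argmin C (MSE Q).
  by move=> FQ; apply: argmin_admissible FP FQ.
split.
- move=> Q rho FQ; split.
    move=> /(argminP _ FQ) rhomin; split; first exact: rhomin.1.
    exact: argmin_unique PP linC rhoCmin rhomin.
  move=> [Crho rho_eq]; apply: argminQ => //; split=> // sigma Csigma.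
  rewrite (ae_eq_MSE PP (mC _ Crho) mrhoC rho_eq).
  exact: rhoCmin.2.
- move=> Q rho FQ /(argminP _ FQ) rhomin.
  rewrite (MSE_admissible A_linear B_linear A_measurable B_measurable AB_L2
    FQ FP rhomin.1).
  by apply/le_anti/andP; split; [exact: rhomin.2 rhoCmin.1|
    exact: rhoCmin.2 rhomin.1].
- have worstC : worst_MSE F rhoC = MSE P rhoC.
    exact: (worst_MSE_sum_space A_linear B_linear A_measurable B_measurable
      AB_L2 FP rhoCmin.1).
  have worst_ge (rho : _ -> 'rV[R]_N) : measurable_fun setT rho ->
      (MSE P rhoC + 'E_P12[fun x => sqnorm (rhoC x - rho x)] <=
       worst_MSE F rho)%E.
    exact: (worst_MSE_ge A_linear B_linear A_measurable B_measurable FP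
      rhoCmin).
  have E_ge0 (rho : _ -> 'rV[R]_N) :
      (0 <= 'E_P12[fun x => sqnorm (rhoC x - rho x)])%E.
    by apply: expectation_ge0 => x; exact: sqnorm_ge0.
  move=> rho; split.
    move=> [mrho rhomin]; split=> //.
    (* The worst error of [rhoC] attains the lower bound [MSE P rhoC]. As this is finite, it cancels
       and leaves a nonpositive mean-square distance. *)
    have := le_trans (worst_ge _ mrho) (rhomin _ mrhoC).
    rewrite worstC (MSE_fin PP rhoC2) -[leRHS]adde0 leeD2lE// => E0.
    have mB : measurable_fun setT (rhoC - rho).
      by rewrite addrC -scaleN1r; exact: measurable_linear.
    have := @expectation_sqnorm_eq0 _ _ _ P12 _ _ mB.
    move=> /(_ (le_anti (introT andP (conj E0 (E_ge0 rho))))).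
    by apply: filterS => x /eqP + _; rewrite subr_eq0 => /eqP ->.
  (* Here [rho] may lie outside [C], but every admissible law has marginal [P12], so [rho] has the
     same error as [rhoC] under each of them. *)
  move=> [mrho rho_eq]; split=> // sigma msigma.
  apply: (@le_trans _ _ (MSE P rhoC)).
    apply: ge_ereal_sup => _ [Q FQ <-].
    rewrite (ae_eq_MSE (admissible_coupling FQ) mrho mrhoC rho_eq).
    by rewrite (MSE_admissible A_linear B_linear A_measurable B_measurable AB_L2
      FQ FP rhoCmin.1).
  by apply: le_trans (worst_ge _ msigma); rewrite leeDl.
Qed.
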